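(* Consider the implicit-explicit scheme described in the context (implicit acoustic step, explicit transport step). Assume that at every time step the Whitham subcharacteristic condition (see context) and the CFL condition $$\max_{1\le j\le N}\frac{\Delta t}{\Delta x_j}\left((u^*_{j-1/2})^+-(u^*_{j+1/2})^-\right)<1$$ hold. Then the scheme satisfies the following stability properties: (i) it is a conservative scheme for $h$, i.e. $h_j^{n+1}=h_j^n-\frac{\Delta t}{\Delta x_j}\left(u^*_{j+1/2}h^{n+1-}_{j+1/2}-u^*_{j-1/2}h^{n+1-}_{j-1/2}\right)$ for all $j\in\{1,\dots,N\}$; it is also a conservative scheme for $hu$ when the topography source term vanishes, i.e. in that case $(hu)_j^{n+1}=(hu)_j^n-\frac{\Delta t}{\Delta x_j}\left(u^*_{j+1/2}(hu)^{n+1-}_{j+1/2}+\Pi^*_{j+1/2}-u^*_{j-1/2}(hu)^{n+1-}_{j-1/2}-\Pi^*_{j-1/2}\right)$; (ii) the water height $h_j^n$ is positive for all $j$ and $n>0$ provided that $h_j^0$ is positive for all $j$; (iii) it is well-balanced: if $u_j^n=0$ and $h_j^n+z_j$ is independent of $j\in\{0,\dots,N+1\}$, and the ghost-cell states are kept unchanged during the step ($\mathbf X^{n+1-}=\mathbf X^n$ in cells $0$ and $N+1$, where $\mathbf X=(h,u,\Pi)$), then $h_j^{n+1}=h_j^n$ and $u_j^{n+1}=0$ for all $j\in\{1,\dots,N\}$; (iv) it satisfies a discrete entropy inequality: there exist numerical entropy fluxes $\mathcal F^{n+1-}_{j+1/2}$ consistent with $\mathcal F$ and a discrete source term $\{hu\,\partial_xz\}_j$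 consistent with $hu\,\partial_xz$ (consistency being defined in the context), such that for all $j\in\{1,\dots,N\}$ $$\mathcal U_j^{n+1}-\mathcal U_j^n+\frac{\Delta t}{\Delta x_j}\left(\mathcal F^{n+1-}_{j+1/2}-\mathcal F^{n+1-}_{j-1/2}\right)\le-\Delta t\,g\,\{hu\,\partial_xz\}_j,$$ where $\mathcal U_j^n=\mathcal U(h_j^n,(hu)_j^n)$; (v) it gives the usual implicit-explicit Lagrange-Projection scheme (see context) when the bottom is flat.
   Context: The shallow water equations are $\partial_th+\partial_x(hu)=0$, $\partial_t(hu)+\partial_x(hu^2+gh^2/2)=-gh\,\partial_xz$, $g>0$, with entropy $\mathcal U=\frac{hu^2}2+\frac{gh^2}2$, entropy flux $\mathcal F=\left(\frac{u^2}2+gh\right)hu$, and entropy inequality $\partial_t\mathcal U+\partial_x\mathcal F\le-ghu\,\partial_xz$. Notation: $v^+=\max(v,0)$, $v^-=\min(v,0)$; $a>0$ is a constant; $\Delta t>0$; cells $j=1,\dots,N$ and ghost cells $j=0,N+1$ (carrying the boundary conditions) have sizes $\Delta x_j>0$ and discrete topography $z_j$. In the ghost cells, the states at times $t^n$ and $t^{n+1-}$ are prescribed, with positive water heights, and are at equilibrium at time $t^n$. Given $(h_j^n,(hu)_j^n)$ with $h_j^n>0$, set $u_j^n=(hu)^n_j/h_j^n$, $\tau_j^n=1/h_j^n$, $\Pi_j^n=g(h_j^n)^2/2$, $\Delta m_j=\Delta x_jh_j^n$, $\Delta m_{j+1/2}=(\Delta m_j+\Delta m_{j+1})/2$, and $$S_{j+1/2}^n=\frac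 g2(h_j^n+h_{j+1}^n)\frac{z_{j+1}-z_j}{\Delta m_{j+1/2}},\qquad S_j^n=\frac12\left(\frac{\Delta m_{j+1/2}}{\Delta m_j}S^n_{j+1/2}+\frac{\Delta m_{j-1/2}}{\Delta m_j}S^n_{j-1/2}\right)$$ (discretizations of the topography source term). Implicit acoustic step, for $1\le j\le N$: $$\tau_j^{n+1-}=\tau_j^n+\frac{\Delta t}{\Delta m_j}(u^*_{j+1/2}-u^*_{j-1/2}),\qquad u_j^{n+1-}=u_j^n-\frac{\Delta t}{\Delta m_j}(\Pi^*_{j+1/2}-\Pi^*_{j-1/2})-\Delta t\,S_j^n,$$ $$\Pi_j^{n+1-}=\Pi_j^n-\frac{\Delta t}{\Delta m_j}a^2(u^*_{j+1/2}-u^*_{j-1/2}),$$ with $$u^*_{j+1/2}=\frac{u_j^{n+1-}+u_{j+1}^{n+1-}}2-\frac{\Pi_{j+1}^{n+1-}-\Pi_j^{n+1-}}{2a}-\frac{\Delta m_{j+1/2}}{2a}S^n_{j+1/2},\qquad \Pi^*_{j+1/2}=\frac{\Pi_j^{n+1-}+\Pi_{j+1}^{n+1-}}2-\frac a2(u_{j+1}^{n+1-}-u_j^{n+1-}).$$ Set $h_j^{n+1-}=1/\tau_j^{n+1-}$, $(hu)_j^{n+1-}=h_j^{n+1-}u_j^{n+1-}$. Explicit transport step, for $\varphi\in\{h,hu\}$, $1\le j\le N$: $$\varphi_j^{n+1}=\varphi_j^{n+1-}-\frac{\Delta t}{\Delta x_j}\left(u^*_{j+1/2}\varphi^{n+1-}_{j+1/2}-u^*_{j-1/2}\varphi^{n+1-}_{j-1/2}\right)+\frac{\Delta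 t}{\Delta x_j}\varphi_j^{n+1-}(u^*_{j+1/2}-u^*_{j-1/2}),$$ with $\varphi^{n+1-}_{j+1/2}=\varphi_j^{n+1-}$ if $u^*_{j+1/2}\ge0$ and $\varphi_{j+1}^{n+1-}$ if $u^*_{j+1/2}<0$. Whitham subcharacteristic condition: $a>\sqrt{g\tau^{-3}}$ (that is $a>c(\tau)/\tau$ with $c^2=g/\tau$) for all values $\tau>0$ spanned by the specific volume during the time step, i.e. all $\tau$ between $\tau_j^n$ and $\tau_j^{n+1-}$, for all $j$. Consistency: write $Y_j=(h_j^n,h_j^{n+1-},u_j^{n+1-},\Pi_j^{n+1-},z_j)$. Entropy fluxes are consistent with $\mathcal F$ if $\mathcal F^{n+1-}_{j+1/2}=\mathbb F(Y_j,Y_{j+1})$ for a continuous function $\mathbb F$ (depending on the parameters $g,a$ only) with $\mathbb F(Y,Y)=\left(\frac{u^2}2+gh\right)hu$ whenever $Y=(h,h,u,gh^2/2,z)$. The source term is consistent with $hu\,\partial_xz$ if $\{hu\,\partial_xz\}_j=\mathbb S(Y_{j-1},Y_j,Y_{j+1},\Delta x_j)$ for a function $\mathbb S$ (depending on $g,a$ only) which tends to $hu\,s$ when $\Delta x_j\to0$, $Y_{j-1},Y_j,Y_{j+1}\to(h,h,u,gh^2/2,\overline z)$ and $\frac{z_{j+1}-z_j}{\Delta x_j},\frac{z_j-z_{j-1}}{\Delta x_j}\to s$. Usual implicit-explicit Lagrange-Projection scheme: the scheme for the barotropic Euler system $\partial_th+\partial_x(hu)=0$, $\partial_t(hu)+\partial_x(hu^2+gh^2/2)=0$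 obtained from the same acoustic and transport formulas with no topography terms, i.e. $u_j^{n+1-}=u_j^n-\frac{\Delta t}{\Delta m_j}(\Pi^*_{j+1/2}-\Pi^*_{j-1/2})$ and $u^*_{j+1/2}=\frac{u_j^{n+1-}+u_{j+1}^{n+1-}}2-\frac{\Pi_{j+1}^{n+1-}-\Pi_j^{n+1-}}{2a}$, all other formulas being unchanged. *)

(* Defs.v *)
From HB Require Import structures.
From mathcomp Require Import all_boot all_order all_algebra.
From mathcomp Require Import boolp classical_sets reals topology normedtype.

Set Implicit Arguments.
Unset Strict Implicit.
Unset Printing Implicit Defensive.

Import Order.TTheory GRing.Theory Num.Theory.
Import numFieldNormedType.Exports.

Local Open Scope classical_set_scope.
Local Open Scope ring_scope.

(* Cell-indexed data are functions of j : nat, of which only the values for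
   0 <= j <= ncell + 1 matter (cells 0 and ncell + 1 are the ghost cells).
   Interface-indexed data at j + 1/2 are indexed by j, so that the left and
   right interfaces of cell j >= 1 have indices j.-1 and j. *)

Record mesh (R : realType) := Mesh {
  ncell : nat ;
  dx : nat -> R ;
  topo : nat -> R }.

(* State at a discrete time t^n. *)
Record state (R : realType) := State {
  height : nat -> R ;
  discharge : nat -> R }.

(* State at t^{n+1-}, after the acoustic step; the pressure is here an
   independent variable. *)
Record acstate (R : realType) := AcState {
  ac_tau : nat -> R ;
  ac_vel : nat -> R ;
  ac_pi : nat -> R }.

Definition interior_cell (R : realType) (m : mesh R) (j : nat) : Prop :=
  (1 <= j <= ncell m)%N.

Definition ghost_cell (R : realType) (m : mesh R) (j : nat) : Prop :=
  j = 0%N \/ j = (ncell m).+1.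

Definition vel (R : realType) (X : state R) (j : nat) : R :=
  discharge X j / height X j.

Definition tau (R : realType) (X : state R) (j : nat) : R := (height X j)^-1.

(* In the ghost cells this encodes that the state at t^n is at equilibrium. *)
Definition pressure (R : realType) (g : R) (X : state R) (j : nat) : R :=
  g * height X j ^+ 2 / 2.

Definition ac_height (R : realType) (Y : acstate R) (j : nat) : R :=
  (ac_tau Y j)^-1.

Definition ac_discharge (R : realType) (Y : acstate R) (j : nat) : R :=
  ac_height Y j * ac_vel Y j.

Definition entropy (R : realType) (g h hu : R) : R :=
  h * (hu / h) ^+ 2 / 2 + g * h ^+ 2 / 2.

Definition entropy_flux (R : realType) (g h u : R) : R :=
  (u ^+ 2 / 2 + g * h) * (h * u).

Definition dm (R : realType) (m : mesh R) (X : state R) (j : nat) : R :=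
  dx m j * height X j.

Definition dm_half (R : realType) (m : mesh R) (X : state R) (j : nat) : R :=
  (dm m X j + dm m X j.+1) / 2.

Definition source_half (R : realType) (g : R) (m : mesh R) (X : state R)
    (j : nat) : R :=
  g / 2 * (height X j + height X j.+1)
    * ((topo m j.+1 - topo m j) / dm_half m X j).

Definition source_cell (R : realType) (g : R) (m : mesh R) (X : state R)
    (j : nat) : R :=
  (dm_half m X j / dm m X j * source_half g m X j
   + dm_half m X j.-1 / dm m X j * source_half g m X j.-1) / 2.

Definition ustar (R : realType) (g a : R) (m : mesh R) (X : state R)
    (Y : acstate R) (j : nat) : R :=
  (ac_vel Y j + ac_vel Y j.+1) / 2 - (ac_pi Y j.+1 - ac_pi Y j) / (2 * a)
  - dm_half m X j / (2 * a) * source_half g m X j.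

Definition pistar (R : realType) (a : R) (Y : acstate R) (j : nat) : R :=
  (ac_pi Y j + ac_pi Y j.+1) / 2 - a / 2 * (ac_vel Y j.+1 - ac_vel Y j).

Definition acoustic_step (R : realType) (g a dt : R) (m : mesh R)
    (X : state R) (Y : acstate R) : Prop :=
  let us := ustar g a m X Y in
  let ps := pistar a Y in
  forall j, interior_cell m j ->
    [/\ ac_tau Y j = tau X j + dt / dm m X j * (us j - us j.-1),
        ac_vel Y j = vel X j - dt / dm m X j * (ps j - ps j.-1)
                     - dt * source_cell g m X j
      & ac_pi Y j = pressure g X j
                    - dt / dm m X j * a ^+ 2 * (us j - us j.-1)].

Definition upwind (R : realType) (us phi : nat -> R) (j : nat) : R :=
  if 0 <= us j then phi j else phi j.+1.

Definition transport_step (R : realType) (dt : R) (m : mesh R)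
    (us phi phi' : nat -> R) : Prop :=
  forall j, interior_cell m j ->
    phi' j = phi j
      - dt / dx m j * (us j * upwind us phi j - us j.-1 * upwind us phi j.-1)
      + dt / dx m j * phi j * (us j - us j.-1).

(* [X], [Y] and [X'] are the states at t^n, t^{n+1-} and t^{n+1}.  The ghost
   values are unconstrained here, hence prescribed arbitrarily. *)
Definition lp_step (R : realType) (g a dt : R) (m : mesh R)
    (X : state R) (Y : acstate R) (X' : state R) : Prop :=
  let us := ustar g a m X Y in
  [/\ acoustic_step g a dt m X Y,
      transport_step dt m us (ac_height Y) (height X')
    & transport_step dt m us (ac_discharge Y) (discharge X')].

(* The usual scheme for the barotropic Euler system, without topography. *)

Definition euler_ustar (R : realType) (a : R) (Y : acstate R) (j : nat) : R :=
  (ac_vel Y j + ac_vel Y j.+1) / 2 - (ac_pi Y j.+1 - ac_pi Y j) / (2 * a).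

Definition euler_acoustic_step (R : realType) (g a dt : R) (m : mesh R)
    (X : state R) (Y : acstate R) : Prop :=
  let us := euler_ustar a Y in
  let ps := pistar a Y in
  forall j, interior_cell m j ->
    [/\ ac_tau Y j = tau X j + dt / dm m X j * (us j - us j.-1),
        ac_vel Y j = vel X j - dt / dm m X j * (ps j - ps j.-1)
      & ac_pi Y j = pressure g X j
                    - dt / dm m X j * a ^+ 2 * (us j - us j.-1)].

Definition euler_lp_step (R : realType) (g a dt : R) (m : mesh R)
    (X : state R) (Y : acstate R) (X' : state R) : Prop :=
  let us := euler_ustar a Y in
  [/\ euler_acoustic_step g a dt m X Y,
      transport_step dt m us (ac_height Y) (height X')
    & transport_step dt m us (ac_discharge Y) (discharge X')].

Definition valid_data (R : realType) (dt : R) (m : mesh R)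
    (X : state R) (Y : acstate R) : Prop :=
  [/\ 0 < dt,
      forall j, (j <= (ncell m).+1)%N -> 0 < dx m j
    & forall j, ghost_cell m j -> 0 < height X j /\ 0 < ac_height Y j].

Definition positive_height (R : realType) (m : mesh R) (X : state R) : Prop :=
  forall j, (j <= (ncell m).+1)%N -> 0 < height X j.

Definition whitham (R : realType) (g a : R) (m : mesh R)
    (X : state R) (Y : acstate R) : Prop :=
  forall j, interior_cell m j -> forall t : R, 0 < t ->
    Num.min (tau X j) (ac_tau Y j) <= t <= Num.max (tau X j) (ac_tau Y j) ->
    Num.sqrt (g * t ^- 3) < a.

(* The quantities in the maximum are nonnegative, so that the default value 0
   of the iterated maximum is harmless. *)
Definition cfl (R : realType) (g a dt : R) (m : mesh R)
    (X : state R) (Y : acstate R) : Prop :=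
  let us := ustar g a m X Y in
  \big[Num.max/0]_(1 <= j < (ncell m).+1)
     (dt / dx m j * (Num.max (us j.-1) 0 - Num.min (us j) 0)) < 1.

(* Arguments of the numerical entropy fluxes and source term:
   (h^n, h^{n+1-}, u^{n+1-}, Pi^{n+1-}, z). *)
Notation cellvars R := (R * R * R * R * R)%type (only parsing).

Definition cell_at (R : realType) (m : mesh R) (X : state R) (Y : acstate R)
    (j : nat) : cellvars R :=
  (height X j, ac_height Y j, ac_vel Y j, ac_pi Y j, topo m j).

Definition equilibrium_cell (R : realType) (g h u z : R) : cellvars R :=
  (h, h, u, g * h ^+ 2 / 2, z).

Definition consistent_flux (R : realType) (g : R)
    (F : cellvars R -> cellvars R -> R) : Prop :=
  continuous (fun p : cellvars R * cellvars R => F p.1 p.2)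
  /\ forall h u z : R,
       F (equilibrium_cell g h u z) (equilibrium_cell g h u z)
       = entropy_flux g h u.

(* The limit is a joint one, along the cells and sizes d > 0 for which both
   difference quotients of the topography (the last component of a cell) tend
   to s. *)
Definition consistent_source (R : realType) (g : R)
    (S : cellvars R -> cellvars R -> cellvars R -> R -> R) : Prop :=
  forall h u z s eps : R, 0 < eps ->
  exists2 delta : R, 0 < delta &
    forall (Yl Yc Yr : cellvars R) (d : R), 0 < d < delta ->
      ball (equilibrium_cell g h u z) delta Yl ->
      ball (equilibrium_cell g h u z) delta Yc ->
      ball (equilibrium_cell g h u z) delta Yr ->
      `|(Yr.2 - Yc.2) / d - s| < delta ->
      `|(Yc.2 - Yl.2) / d - s| < delta ->
      `|S Yl Yc Yr d - h * u * s| < eps.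

(* Main.v *)
(* The implicit acoustic step is diagonalized by the Riemann invariants
   [w+- := Pi +- a u]: at rest, the deviation of [w+] from equilibrium at cell
   [j + 1] is proportional to that at cell [j], and the one of [w-] at [j] to
   that at [j + 1], so the ghost cells force both to vanish.

   For the entropy inequality, the flux is [ps * us] plus the upwinded entropy
   [U^{n+1-}].  Multiplying the velocity equation by [u^{n+1-}] and the pressure
   equation by [Pi^{n+1-} / a ^ 2] gives a balance whose interface dissipation
   is [(dw ^ 2 + s dw) / (4 a)], with [s = g (h_j + h_{j+1}) (z_{j+1} - z_j) / 2].
   It is at least [- s ^ 2 / (16 a)], which is second order in the topography
   jump and can be put in the source term.  The Whitham condition compares the
   energy [Pi ^ 2 / (2 a ^ 2)] with the true internal energy [g / (2 tau)], and
   under the CFL condition the transport step is a convex combination, to which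
   Jensen's inequality applies. *)

Require Import Defs.
From HB Require Import structures.
From mathcomp Require Import all_boot all_order all_algebra.
From mathcomp Require Import boolp classical_sets reals topology normedtype.
From mathcomp Require Import ring lra.

Set Implicit Arguments.
Unset Strict Implicit.
Unset Printing Implicit Defensive.

Import Order.TTheory GRing.Theory Num.Theory.
Import numFieldNormedType.Exports.

Local Open Scope ring_scope.

(** * Convexity of the energies and acoustic dissipation *)

(* Under the Whitham condition, [- p'(tau) = g / tau ^ 3 <= a ^ 2], so the
   internal energy [g / (2 tau)] lies below its Taylor parabola of curvature
   [a ^ 2] at [t0]. *)
Lemma internal_energy_le (R : realType) (g a t0 t1 : R) :
  0 < g -> 0 < a -> 0 < t0 -> 0 < t1 ->
  (forall t, 0 < t -> Num.min t0 t1 <= t <= Num.max t0 t1 ->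
     Num.sqrt (g * t ^- 3) < a) ->
  g / (2 * t1) <= g / (2 * t0) + g / (2 * t0 ^+ 2) * (t0 - t1)
                  + a ^+ 2 / 2 * (t0 - t1) ^+ 2.
Proof.
move=> g0 a0 t00 t10 W.
have ga t : 0 < t -> Num.min t0 t1 <= t <= Num.max t0 t1 ->
    g <= a ^+ 2 * t ^+ 3.
  move=> tp /(W _ tp) h; have t3 : 0 < t ^+ 3 by rewrite exprn_gt0.
  rewrite -ler_pdivrMr // -(@sqr_sqrtr _ (g / _)); last first.
    by rewrite divr_ge0 ?ltW.
  by rewrite lerXn2r ?nnegrE ?sqrtr_ge0 ?(ltW a0) // ltW.
(* This is the bound at the smaller endpoint [t], because [t ^ 3 <= t0 ^ 2 * t1]. *)
have key : g <= a ^+ 2 * (t0 ^+ 2 * t1).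
  case: (leP t0 t1) ga => h ga.
    apply: le_trans (ga t0 t00 _) _; first by rewrite lexx h.
    by rewrite ler_wpM2l ?sqr_ge0 // exprSr ler_wpM2l ?sqr_ge0.
  apply: le_trans (ga t1 t10 _) _; first by rewrite lexx ltW.
  rewrite ler_wpM2l ?sqr_ge0 // exprSr ler_wpM2r ?(ltW t10) //.
  by rewrite lerXn2r ?nnegrE ?ltW.
rewrite -subr_ge0.
have -> : g / (2 * t0) + g / (2 * t0 ^+ 2) * (t0 - t1)
    + a ^+ 2 / 2 * (t0 - t1) ^+ 2 - g / (2 * t1)
  = (t0 - t1) ^+ 2 * (a ^+ 2 * (t0 ^+ 2 * t1) - g) / (2 * (t0 ^+ 2 * t1)).
  by field; rewrite !gt_eqF.
have t01 : 0 <= t0 ^+ 2 * t1 by rewrite mulr_ge0 ?sqr_ge0 // ltW.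
by rewrite divr_ge0 //; apply: mulr_ge0; rewrite ?sqr_ge0 ?subr_ge0.
Qed.

(* The value at [(h, q)] of the tangent plane of the entropy at the state of
   height [k] and velocity [v]. *)
Definition entropy_tangent (R : realType) (g k v h q : R) : R :=
  q * v - h * v ^+ 2 / 2 + g * h * k - g * k ^+ 2 / 2.

(** By convexity of the entropy in [(h, h u)]: the gap is a sum of two weighted squares. *)
Lemma entropy_tangent_le (R : realType) (g k v h u : R) :
  0 < g -> 0 < h ->
  entropy_tangent g k v h (h * u) <= h * u ^+ 2 / 2 + g * h ^+ 2 / 2.
Proof.
move=> g0 h0; rewrite /entropy_tangent -subr_ge0.
have -> : h * u ^+ 2 / 2 + g * h ^+ 2 / 2
   - (h * u * v - h * v ^+ 2 / 2 + g * h * k - g * k ^+ 2 / 2)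
   = h * (u - v) ^+ 2 / 2 + g * (h - k) ^+ 2 / 2 by field.
by rewrite addr_ge0 // divr_ge0 // mulr_ge0 ?sqr_ge0 // ltW.
Qed.

Lemma entropy_tangentE (R : realType) (g h q : R) :
  0 < h -> entropy g h q = entropy_tangent g h (q / h) h q.
Proof.
by move=> h0; rewrite /entropy /entropy_tangent; field; rewrite gt_eqF.
Qed.

(* With [w+- := Pi +- a u], the difference of the two sides is
   [((dw- + sr / 2) ^ 2 + (dw+ + sl / 2) ^ 2) / (4 a)], where [dw-] is the jump
   of [w-] at the right interface and [dw+] that of [w+] at the left one. *)
Lemma acoustic_dissipation (R : realType) (a ul uc ur pl pc pr sl sr : R) :
  0 < a ->
  let usl := (ul + uc) / 2 - (pc - pl) / (2 * a) - sl / (2 * a) in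
  let usr := (uc + ur) / 2 - (pr - pc) / (2 * a) - sr / (2 * a) in
  let psl := (pl + pc) / 2 - a / 2 * (uc - ul) in
  let psr := (pc + pr) / 2 - a / 2 * (ur - uc) in
  psr * usr - psl * usl - (sr ^+ 2 + sl ^+ 2) / (16 * a)
     + uc * (sr + sl) / 2
  <= uc * (psr - psl + (sr + sl) / 2) + pc * (usr - usl).
Proof.
move=> a0 /=; rewrite -subr_ge0.
set rhs := (X in 0 <= X).
have -> : rhs = (((pr - a * ur) - (pc - a * uc) + sr / 2) ^+ 2
                 + ((pc + a * uc) - (pl + a * ul) + sl / 2) ^+ 2) / (4 * a).
  by rewrite /rhs; field; rewrite gt_eqF.
by rewrite divr_ge0 ?addr_ge0 ?sqr_ge0 // mulr_ge0 // ltW.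
Qed.

(** * Numerical flux and source, and their consistency *)

(* [dm_half * source_half] at the interface between [c] and [d], in a form that
   is polynomial in the cell data (see [dm_half_source_half]). *)
Definition bed_jump (R : realType) (g : R) (c d : cellvars R) : R :=
  g / 2 * (c.1.1.1.1 + d.1.1.1.1) * (d.2 - c.2).

Definition num_ustar (R : realType) (g a : R) (c d : cellvars R) : R :=
  (c.1.1.2 + d.1.1.2) / 2 - (d.1.2 - c.1.2) / (2 * a)
  - bed_jump g c d / (2 * a).

Definition num_pistar (R : realType) (a : R) (c d : cellvars R) : R :=
  (c.1.2 + d.1.2) / 2 - a / 2 * (d.1.1.2 - c.1.1.2).

Definition num_entropy (R : realType) (g : R) (c : cellvars R) : R :=
  c.1.1.1.2 * c.1.1.2 ^+ 2 / 2 + g * c.1.1.1.2 ^+ 2 / 2.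

(** Positive and negative parts replace the sign test of [upwind], which makes continuity
    immediate. *)
Definition num_flux (R : realType) (g a : R) (c d : cellvars R) : R :=
  num_pistar a c d * num_ustar g a c d
  + Num.max (num_ustar g a c d) 0 * num_entropy g c
  + Num.min (num_ustar g a c d) 0 * num_entropy g d.

(** The squared jumps compensate the possibly negative interface dissipation. Divided by [d] they
    still vanish in the limit, each jump being of order [d]. *)
Definition num_source (R : realType) (g a : R) (l c r : cellvars R)
    (d : R) : R :=
  (c.1.1.2 * (bed_jump g c r + bed_jump g l c) / 2
   - (bed_jump g c r ^+ 2 + bed_jump g l c ^+ 2) / (16 * a)) / (g * d).

Section Continuity.
Variables (R : realType) (T : topologicalType).
Implicit Types f h : T -> R.

Lemma fun_continuousD f h : continuous f -> continuous h ->
  continuous (fun x => f x + h x).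
Proof. by move=> cf ch x; apply: cvgD; [exact: cf|exact: ch]. Qed.

Lemma fun_continuousN f : continuous f -> continuous (fun x => - f x).
Proof. by move=> cf x; apply: cvgN; exact: cf. Qed.

Lemma fun_continuousM f h : continuous f -> continuous h ->
  continuous (fun x => f x * h x).
Proof. by move=> cf ch x; apply: cvgM; [exact: cf|exact: ch]. Qed.

Lemma fun_continuous_sqr f : continuous f -> continuous (fun x => f x ^+ 2).
Proof. by move=> cf; apply: fun_continuousM. Qed.

Lemma fun_continuous_max f h : continuous f -> continuous h ->
  continuous (fun x => Num.max (f x) (h x)).
Proof. by move=> cf ch x; exact: (continuous_max (cf x) (ch x)). Qed.

Lemma fun_continuous_min f h : continuous f -> continuous h ->
  continuous (fun x => Num.min (f x) (h x)).
Proof. by move=> cf ch x; exact: (continuous_min (cf x) (ch x)). Qed.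

End Continuity.

Section ContinuousProj.
Variables (T U V : topologicalType).

Lemma continuous_fst (f : T -> U * V) :
  continuous f -> continuous (fun x => (f x).1).
Proof. by move=> cf x; apply: (continuous_comp (cf x)); exact: cvg_fst. Qed.

Lemma continuous_snd (f : T -> U * V) :
  continuous f -> continuous (fun x => (f x).2).
Proof. by move=> cf x; apply: (continuous_comp (cf x)); exact: cvg_snd. Qed.

End ContinuousProj.

Ltac continuity :=
  lazymatch goal with
  | |- continuous (fun x => x) => by move=> ?; exact: cvg_id
  | |- continuous (fun x => @?f x + @?h x) =>
      apply: (@fun_continuousD _ _ f h); continuity
  | |- continuous (fun x => - @?f x) =>
      apply: (@fun_continuousN _ _ f); continuity
  | |- continuous (fun x => @?f x * @?h x) =>
      apply: (@fun_continuousM _ _ f h); continuity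
  | |- continuous (fun x => @?f x ^+ 2) =>
      apply: (@fun_continuous_sqr _ _ f); continuity
  | |- continuous (fun x => Num.max (@?f x) (@?h x)) =>
      apply: (@fun_continuous_max _ _ f h); continuity
  | |- continuous (fun x => Num.min (@?f x) (@?h x)) =>
      apply: (@fun_continuous_min _ _ f h); continuity
  | |- continuous (fun x => (@?f x).1) =>
      apply: (@continuous_fst _ _ _ f); continuity
  | |- continuous (fun x => (@?f x).2) =>
      apply: (@continuous_snd _ _ _ f); continuity
  | |- _ => by move=> ?; exact: cvg_cst
  end.

Lemma num_flux_consistent (R : realType) (g a : R) :
  0 < a -> consistent_flux g (num_flux g a).
Proof.
move=> a0; split; first by rewrite /num_flux /num_pistar /num_entropy
  /num_ustar /bed_jump; continuity.
move=> h u z; rewrite /num_flux /num_pistar /num_ustar /bed_jump /=.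
have -> : (u + u) / 2 = u by field.
rewrite !subrr !(mulr0, mul0r, subr0) /num_entropy /entropy_flux /=.
by case: (leP u 0) => _; field.
Qed.

Lemma num_source_consistent (R : realType) (g a : R) :
  0 < g -> 0 < a -> consistent_source g (num_source g a).
Proof.
move=> g0 a0 h u z s eps eps0.
pose jump_slope (c d : cellvars R) (q : R) :=
  g / 2 * (c.1.1.1.1 + d.1.1.1.1) * q.
(* [num_source] divides by [d]; [Q] takes the difference quotients as separate variables and so is
   continuous. Each squared jump keeps one undivided factor, which is zero at [e]. *)
pose Q (p : cellvars R * cellvars R * cellvars R * (R * R)) :=
  (p.1.1.2.1.1.2 * (jump_slope p.1.1.2 p.1.2 p.2.1
                    + jump_slope p.1.1.1 p.1.1.2 p.2.2) / 2
   - (jump_slope p.1.1.2 p.1.2 p.2.1 * bed_jump g p.1.1.2 p.1.2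
      + jump_slope p.1.1.1 p.1.1.2 p.2.2 * bed_jump g p.1.1.1 p.1.1.2)
     / (16 * a)) / g.
have cQ : continuous Q by rewrite /Q /jump_slope /bed_jump; continuity.
pose e := equilibrium_cell g h u z.
have QE : Q (e, e, e, (s, s)) = h * u * s.
  rewrite /Q /jump_slope /bed_jump /e /= !subrr !mulr0 addr0 mul0r subr0.
  by field; rewrite gt_eqF.
have /cvgrPdist_lt/(_ _ eps0) := cQ (e, e, e, (s, s)).
rewrite QE => /nbhs_ballP[delta /= delta0 dP].
exists delta => // Yl Yc Yr d /andP[d0 _] bl bc br qr ql.
have := dP (Yl, Yc, Yr, ((Yr.2 - Yc.2) / d, (Yc.2 - Yl.2) / d)).
have -> : Q (Yl, Yc, Yr, ((Yr.2 - Yc.2) / d, (Yc.2 - Yl.2) / d))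
    = num_source g a Yl Yc Yr d.
  rewrite /Q /jump_slope /num_source /bed_jump /=.
  by field; rewrite !gt_eqF.
rewrite distrC; apply; split; first by split => //; split.
by split; rewrite -ball_normE /= distrC.
Qed.

(** * Upwind transport and the CFL condition *)

Lemma upwind_flux (R : realType) (us phi : nat -> R) j :
  us j * upwind us phi j
  = Num.max (us j) 0 * phi j + Num.min (us j) 0 * phi j.+1.
Proof.
by rewrite /upwind; case: (leP 0 (us j)) => _; rewrite mul0r ?addr0 ?add0r.
Qed.

Lemma maxr0_minr0 (R : realDomainType) (x : R) :
  x = Num.max x 0 + Num.min x 0.
Proof. by case: (leP x 0) => _; rewrite ?addr0 ?add0r. Qed.

(** The three weights sum to 1, so the CFL condition will make this a convex combination. *)
Lemma transport_stepE (R : realType) (dt : R) (m : mesh R)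
    (us phi phi' : nat -> R) :
  transport_step dt m us phi phi' ->
  forall j, interior_cell m j.+1 ->
    phi' j.+1
    = (1 - dt / dx m j.+1 * (Num.max (us j) 0 - Num.min (us j.+1) 0)) * phi j.+1
      + dt / dx m j.+1 * Num.max (us j) 0 * phi j
      + dt / dx m j.+1 * - Num.min (us j.+1) 0 * phi j.+2.
Proof.
move=> tr j /tr ->; rewrite /= !upwind_flux.
rewrite {3}(maxr0_minr0 (us j.+1)) {3}(maxr0_minr0 (us j)); ring.
Qed.

Lemma cfl_cell (R : realType) (g a dt : R) (m : mesh R) X Y :
  cfl g a dt m X Y -> forall j, interior_cell m j.+1 ->
  dt / dx m j.+1 * (Num.max (ustar g a m X Y j) 0
                    - Num.min (ustar g a m X Y j.+1) 0) < 1.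
Proof.
move=> H j ij; apply: le_lt_trans H.
apply: (le_bigmax_seq _ j.+1 xpredT
  (fun j => dt / dx m j * (Num.max (ustar g a m X Y j.-1) 0
                    - Num.min (ustar g a m X Y j) 0))) => //.
by rewrite mem_index_iota ltnS.
Qed.

Lemma interior_le (R : realType) (m : mesh R) j :
  interior_cell m j -> (j <= (ncell m).+1)%N.
Proof. by move=> /andP[_ h]; exact: leqW. Qed.

Lemma interior_or_ghost (R : realType) (m : mesh R) j :
  (j <= (ncell m).+1)%N -> interior_cell m j \/ ghost_cell m j.
Proof.
case: j => [|j]; first by right; left.
rewrite leq_eqVlt => /orP[/eqP|]; first by right; right.
by left; rewrite /interior_cell /= -ltnS.
Qed.

(** * One time step: conservation and positivity *)

Section Step.
Variables (R : realType) (g a dt : R) (m : mesh R).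
Variables (X : state R) (Y : acstate R) (X' : state R).
Hypotheses (g_gt0 : 0 < g) (a_gt0 : 0 < a) (data : valid_data dt m X Y).
Hypothesis Xpos : positive_height m X.

Let us := ustar g a m X Y.
Let ps := pistar a Y.
Let c := cell_at m X Y.

Let dt_gt0 : 0 < dt. Proof. by case: data. Qed.
Let dx_gt0 j : (j <= (ncell m).+1)%N -> 0 < dx m j.
Proof. by case: data => _ + _; exact. Qed.

Lemma dm_gt0 j : (j <= (ncell m).+1)%N -> 0 < dm m X j.
Proof. by move=> jN; rewrite mulr_gt0 ?dx_gt0 ?Xpos. Qed.

Lemma dm_half_source_half j : (j <= ncell m)%N ->
  dm_half m X j * source_half g m X j = bed_jump g (c j) (c j.+1).
Proof.
move=> jN; have h : 0 < dm_half m X j.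
  by rewrite divr_gt0 // addr_gt0 // dm_gt0 // ltnW.
by rewrite /source_half /bed_jump /=; field; rewrite gt_eqF.
Qed.

Lemma ustarE j : (j <= ncell m)%N -> us j = num_ustar g a (c j) (c j.+1).
Proof.
by move=> jN; rewrite /us /ustar mulrAC dm_half_source_half.
Qed.

Lemma dm_source_cell j : interior_cell m j.+1 ->
  dm m X j.+1 * source_cell g m X j.+1
  = (bed_jump g (c j.+1) (c j.+2) + bed_jump g (c j) (c j.+1)) / 2.
Proof.
move=> ij; have jN : (j < ncell m)%N by case/andP: ij.
rewrite -!dm_half_source_half ?(ltnW jN) // /source_cell /=.
by field; rewrite gt_eqF // dm_gt0 // interior_le.
Qed.

(* If [ac_tau Y j <= 0], the Whitham condition would bound [g / t ^ 3] for all
   small [t > 0]. *)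
Lemma whitham_tau_gt0 :
  whitham g a m X Y -> forall j, interior_cell m j -> 0 < ac_tau Y j.
Proof.
move=> W j ij; rewrite ltNge; apply/negP => tY.
have tX : 0 < tau X j by rewrite invr_gt0 Xpos // interior_le.
(* As [t <= 1], [t ^ 3 <= t <= g / a ^ 2], so the square root is at least [a]; the bound by
   [tau X j] keeps [t] in the Whitham interval. *)
pose t := Num.min (tau X j) (Num.min 1 (g / a ^+ 2)).
have t0 : 0 < t by rewrite !lt_min tX ltr01 divr_gt0 // exprn_gt0.
have := W j ij t t0; rewrite (min_r (le_trans tY (ltW tX))).
rewrite (max_l (le_trans tY (ltW tX))) (le_trans tY (ltW t0)) ge_min lexx /=.
move=> /(_ isT); apply/negP; rewrite -leNgt.
rewrite -[a]gtr0_norm // -sqrtr_sqr ler_wsqrtr // ler_pdivlMr ?exprn_gt0 //.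
have t1 : t <= 1 by rewrite !ge_min lexx !orbT.
have tg : t <= g / a ^+ 2 by rewrite !ge_min lexx !orbT.
rewrite mulrC -ler_pdivlMr ?exprn_gt0 //; apply: le_trans tg.
by rewrite -[leRHS]expr1 ler_wiXn2l // ltW.
Qed.

Lemma ac_height_gt0 : whitham g a m X Y ->
  forall j, (j <= (ncell m).+1)%N -> 0 < ac_height Y j.
Proof.
move=> W j /interior_or_ghost[/(whitham_tau_gt0 W)|gj].
  by rewrite /ac_height invr_gt0.
by case: data => _ _ /(_ _ gj)[].
Qed.

(** This is the [tau] update multiplied by both heights, with [dm = dx * height]. The left side is
    what the transport step keeps outside its flux difference. *)
Lemma height_lagrange : acoustic_step g a dt m X Y -> whitham g a m X Y ->
  forall j, interior_cell m j ->
    ac_height Y j * (1 + dt / dx m j * (us j - us j.-1)) = height X j.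
Proof.
move=> A W j ij; have [tE _ _] := A j ij.
have := whitham_tau_gt0 W ij; rewrite /ac_height tE -/us => t0.
have jN := interior_le ij.
have [h0 d0] := (Xpos jN, dx_gt0 jN).
move: t0; rewrite /tau /dm => t0; apply: (mulfI (lt0r_neq0 t0)).
rewrite mulrA mulfV ?gt_eqF // mul1r.
by field; rewrite !gt_eqF.
Qed.

Lemma height_conservative : lp_step g a dt m X Y X' -> whitham g a m X Y ->
  forall j, interior_cell m j ->
    height X' j = height X j
      - dt / dx m j * (us j * upwind us (ac_height Y) j
                       - us j.-1 * upwind us (ac_height Y) j.-1).
Proof.
move=> [A tr _] W j ij; rewrite (tr _ ij) -(height_lagrange A W ij) -/us; ring.
Qed.

Lemma discharge_balance : lp_step g a dt m X Y X' -> whitham g a m X Y ->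
  forall j, interior_cell m j ->
    discharge X' j = discharge X j
      - dt / dx m j * (us j * upwind us (ac_discharge Y) j + ps j
                       - us j.-1 * upwind us (ac_discharge Y) j.-1
                       - ps j.-1)
      - dt * height X j * source_cell g m X j.
Proof.
move=> [A _ tr] W j ij; have [_ uE _] := A _ ij.
have jN := interior_le ij.
have huE : ac_discharge Y j * (1 + dt / dx m j * (us j - us j.-1))
    = discharge X j - dt / dx m j * (ps j - ps j.-1)
      - dt * height X j * source_cell g m X j.
  rewrite /ac_discharge mulrAC (height_lagrange A W ij) uE -/ps /vel /dm.
  by field; rewrite !gt_eqF ?Xpos ?dx_gt0.
(* The left side is rewritten as itself [- v + v], and [huE] is applied to the added [v] alone. *)
set v := ac_discharge Y j * (1 + _) in huE.
by rewrite (tr _ ij) -/us -[LHS](addrNK v) {2}huE /v; ring.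
Qed.

(** The strict CFL inequality gives the central cell a positive weight; the neighbours contribute
    nonnegative terms. *)
Lemma height_step_gt0 : lp_step g a dt m X Y X' -> whitham g a m X Y ->
  cfl g a dt m X Y -> forall j, interior_cell m j -> 0 < height X' j.
Proof.
move=> [A tr _] W C [//|j] ij; have jN := interior_le ij.
have l0 : 0 < dt / dx m j.+1 by rewrite divr_gt0 ?dx_gt0.
rewrite (transport_stepE tr ij) -addrA ltr_wpDr //.
  have hp k : (k <= (ncell m).+1)%N -> 0 <= ac_height Y k.
    by move=> ?; rewrite ltW // ac_height_gt0.
  have j2 : (j.+2 <= (ncell m).+1)%N by rewrite ltnS; case/andP: ij.
  rewrite addr_ge0 // mulr_ge0 ?hp ?(ltnW jN) // mulr_ge0 ?(ltW l0) //.
    by rewrite le_max lexx orbT.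
  by rewrite oppr_ge0 ge_min lexx orbT.
by rewrite mulr_gt0 ?ac_height_gt0 // subr_gt0 cfl_cell.
Qed.

(** * Discrete entropy inequality *)

(** Jensen's inequality through the tangent plane at the new state: being affine, it commutes with
    the convex combination, and it lies below the entropy at the three cells. *)
Lemma entropy_transport : lp_step g a dt m X Y X' -> whitham g a m X Y ->
  cfl g a dt m X Y -> forall j, interior_cell m j.+1 ->
  entropy g (height X' j.+1) (discharge X' j.+1)
  <= (1 - dt / dx m j.+1 * (Num.max (us j) 0 - Num.min (us j.+1) 0))
       * num_entropy g (c j.+1)
     + dt / dx m j.+1 * Num.max (us j) 0 * num_entropy g (c j)
     + dt / dx m j.+1 * - Num.min (us j.+1) 0 * num_entropy g (c j.+2).
Proof.
move=> L W C j ij; have h0 := height_step_gt0 L W C ij.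
rewrite entropy_tangentE //; case: L => [_ trh trq].
set k := height X' j.+1 in h0 *; set v := discharge X' j.+1 / k.
have jN := interior_le ij.
have j2 : (j.+2 <= (ncell m).+1)%N by rewrite ltnS; case/andP: ij.
have l0 : 0 <= dt / dx m j.+1 by rewrite divr_ge0 ?ltW ?dx_gt0.
have T i : (i <= (ncell m).+1)%N ->
    entropy_tangent g k v (ac_height Y i) (ac_discharge Y i)
    <= num_entropy g (c i).
  by move=> iN; apply: entropy_tangent_le => //; exact: ac_height_gt0.
have w1 : 0 <= 1 - dt / dx m j.+1 * (Num.max (us j) 0 - Num.min (us j.+1) 0).
  by rewrite subr_ge0 ltW // cfl_cell.
have w2 : 0 <= dt / dx m j.+1 * Num.max (us j) 0.
  by rewrite mulr_ge0 // le_max lexx orbT.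
have w3 : 0 <= dt / dx m j.+1 * - Num.min (us j.+1) 0.
  by rewrite mulr_ge0 // oppr_ge0 ge_min lexx orbT.
apply: le_trans (lerD (lerD (ler_wpM2l w1 (T j.+1 jN))
  (ler_wpM2l w2 (T j (ltnW jN)))) (ler_wpM2l w3 (T j.+2 j2))).
(* Here [k] is both the argument and the base point of the tangent plane; it is expanded only as
   argument. *)
rewrite [in X in X <= _]/entropy_tangent {1 2}/k (transport_stepE trh ij).
rewrite (transport_stepE trq ij) -/us /entropy_tangent.
by rewrite le_eqVlt; apply/orP; left; apply/eqP; ring.
Qed.

Lemma entropy_acoustic : acoustic_step g a dt m X Y -> whitham g a m X Y ->
  forall j, interior_cell m j.+1 ->
  (1 + dt / dx m j.+1 * (us j.+1 - us j)) * num_entropy g (c j.+1)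
  <= entropy g (height X j.+1) (discharge X j.+1)
     - dt / dx m j.+1 * (num_pistar a (c j.+1) (c j.+2) * us j.+1
                         - num_pistar a (c j) (c j.+1) * us j)
     - dt * g * num_source g a (c j) (c j.+1) (c j.+2) (dx m j.+1).
Proof.
move=> A W j ij; have jN := interior_le ij.
have [jm jm'] : (j <= ncell m)%N /\ (j.+1 <= ncell m)%N.
  by case/andP: ij => _ h; split => //; exact: ltnW.
have [h0 d0] := (Xpos jN, dx_gt0 jN).
have Y0 := whitham_tau_gt0 W ij.
have HL := height_lagrange A W ij.
have SE := dm_source_cell ij.
have [tE uE pE] := A _ ij.
have IE := internal_energy_le g_gt0 a_gt0 _ Y0 (W _ ij).
rewrite invr_gt0 in IE; move/(_ h0): IE.
have := acoustic_dissipation (ac_vel Y j) (ac_vel Y j.+1) (ac_vel Y j.+2)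
  (ac_pi Y j) (ac_pi Y j.+1) (ac_pi Y j.+2)
  (bed_jump g (c j) (c j.+1)) (bed_jump g (c j.+1) (c j.+2)) a_gt0.
rewrite /= -/(num_ustar g a (c j) (c j.+1)) -/(num_ustar g a (c j.+1) (c j.+2)).
rewrite -!ustarE // -/(num_pistar a (c j) (c j.+1)).
rewrite -/(num_pistar a (c j.+1) (c j.+2)).
set D := us j.+1 - us j in tE pE HL *.
set Jr := bed_jump g (c j.+1) (c j.+2); set Jl := bed_jump g (c j) (c j.+1).
set low := (X in X <= _ -> _) => diss IE.
set P := num_pistar a (c j.+1) (c j.+2) - num_pistar a (c j) (c j.+1) in diss.
pose k := dt / dm m X j.+1.
have k0 : 0 <= k by rewrite divr_ge0 // ltW // dm_gt0.
(* Using the implicit pressure adds [(a * k * D) ^ 2], twice the quadratic term of the Taylor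
   bound. *)
have {}IE : g / (2 * ac_tau Y j.+1)
    <= g / (2 * tau X j.+1) - k * (ac_pi Y j.+1 * D).
  apply: le_trans IE _; rewrite pE tE -/k /tau /pressure -subr_ge0.
  set r := (X in 0 <= X); have -> : r = (a * k * D) ^+ 2 / 2.
    by rewrite /r; field; rewrite gt_eqF.
  by rewrite divr_ge0 ?sqr_ge0.
have {}uE : ac_vel Y j.+1 = vel X j.+1 - k * (P + (Jr + Jl) / 2).
  have kS : dt * source_cell g m X j.+1 = k * ((Jr + Jl) / 2).
    by rewrite -SE /k; field; rewrite gt_eqF // dm_gt0.
  by rewrite uE kS -/k /P /num_pistar /pistar /c /cell_at /=; ring.
(* Testing an implicit update with the new velocity leaves half the squared increment as
   dissipation. *)
have KE : ac_vel Y j.+1 ^+ 2 / 2 <= vel X j.+1 ^+ 2 / 2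
    - k * (ac_vel Y j.+1 * (P + (Jr + Jl) / 2)).
  rewrite -subr_ge0; set r := (X in 0 <= X).
  have -> : r = (k * (P + (Jr + Jl) / 2)) ^+ 2 / 2 by rewrite /r uE; field.
  by rewrite divr_ge0 ?sqr_ge0.
have := ler_wpM2l (ltW h0) (lerD (lerD KE IE) (ler_wpM2l k0 diss)).
have -> : (1 + dt / dx m j.+1 * D) * num_entropy g (c j.+1)
   = height X j.+1 * (ac_vel Y j.+1 ^+ 2 / 2 + g / (2 * ac_tau Y j.+1)).
  rewrite -HL /num_entropy /c /cell_at /= /ac_height.
  by field; rewrite !gt_eqF.
(* The summed estimates, weighted by [height X], and the goal have the same gap; only an identity
   remains. *)
move=> fin; rewrite -subr_ge0; move: fin; rewrite -subr_ge0.
congr (0 <= _); rewrite /low /entropy /vel /num_source -/Jr -/Jl /k /dm /tau /P.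
rewrite /c /cell_at /=; by field; rewrite !gt_eqF.
Qed.

(** The central transport weight is the acoustic factor [1 + dt / dx * (us j.+1 - us j)] minus the
    outflow through both interfaces. That outflow is the central cell's share of the two upwind
    fluxes, so the two inequalities add up. *)
Lemma entropy_step : lp_step g a dt m X Y X' -> whitham g a m X Y ->
  cfl g a dt m X Y -> forall j, interior_cell m j.+1 ->
  entropy g (height X' j.+1) (discharge X' j.+1)
    - entropy g (height X j.+1) (discharge X j.+1)
    + dt / dx m j.+1 * (num_flux g a (c j.+1) (c j.+2)
                        - num_flux g a (c j) (c j.+1))
  <= - (dt * g * num_source g a (c j) (c j.+1) (c j.+2) (dx m j.+1)).
Proof.
move=> L W C j ij; have T := entropy_transport L W C ij.
case: L => A _ _; have {}A := entropy_acoustic A W ij.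
have [jm jm'] : (j <= ncell m)%N /\ (j.+1 <= ncell m)%N.
  by case/andP: ij => _ h; split => //; exact: ltnW.
rewrite /num_flux -!ustarE //.
have E : us j.+1 - us j = Num.max (us j.+1) 0 + Num.min (us j.+1) 0
    - (Num.max (us j) 0 + Num.min (us j) 0) by rewrite -!maxr0_minr0.
by rewrite E in A; lra.
Qed.

(** * Well-balancing at the lake at rest *)

Hypothesis lake_at_rest : forall j, (j <= (ncell m).+1)%N -> vel X j = 0.
Hypothesis flat_surface : forall j k,
  (j <= (ncell m).+1)%N -> (k <= (ncell m).+1)%N ->
  height X j + topo m j = height X k + topo m k.
Hypothesis ghost_unchanged : forall j, ghost_cell m j ->
  [/\ ac_height Y j = height X j, ac_vel Y j = vel X j
    & ac_pi Y j = pressure g X j].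

(** Discrete hydrostatic balance: the mean height times the opposite of the height jump is a
    difference of squares. *)
Lemma bed_jump_at_rest j : (j <= ncell m)%N ->
  bed_jump g (c j) (c j.+1) = pressure g X j - pressure g X j.+1.
Proof.
move=> jm; rewrite /bed_jump /pressure /=.
have -> : topo m j.+1 = height X j + topo m j - height X j.+1.
  by rewrite (@flat_surface j j.+1) ?ltnS // ?(leqW jm) // addrC addKr.
by field.
Qed.

Let wp j := ac_pi Y j - pressure g X j + a * ac_vel Y j.
Let wm j := ac_pi Y j - pressure g X j - a * ac_vel Y j.

(** Once the bed jumps cancel the equilibrium pressures, the combinations [a * Dus + Dps + sg] and
    [a * Dus - Dps - sg] are one-sided differences of [wp] and [wm]. *)
Lemma riemann_recursion : acoustic_step g a dt m X Y ->
  forall j, interior_cell m j.+1 ->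
  (1 + dt / dm m X j.+1 * a) * wp j.+1 = dt / dm m X j.+1 * a * wp j
  /\ (1 + dt / dm m X j.+1 * a) * wm j.+1 = dt / dm m X j.+1 * a * wm j.+2.
Proof.
move=> A j ij; have [_ uE pE] := A _ ij; have jN := interior_le ij.
have [jm jm'] : (j <= ncell m)%N /\ (j.+1 <= ncell m)%N.
  by case/andP: ij => _ h; split => //; exact: ltnW.
set k := dt / dm m X j.+1.
have := dm_source_cell ij; rewrite !bed_jump_at_rest // => SE.
have {SE} kS : dt * source_cell g m X j.+1
    = k * ((pressure g X j.+1 - pressure g X j.+2
            + (pressure g X j - pressure g X j.+1)) / 2).
  by rewrite -SE /k; field; rewrite gt_eqF // dm_gt0.
move: uE pE; rewrite kS lake_at_rest // -/k -/us !ustarE //= /num_ustar.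
rewrite !bed_jump_at_rest // /pistar /c /cell_at /= => uE pE.
set Dus := (X in k * a ^+ 2 * X) in pE.
set Dps := (X in 0 - k * X) in uE.
set sg := (X in _ - k * X) in uE.
have wpE : wp j.+1 = - (k * a) * (a * Dus + Dps + sg).
  by rewrite /wp pE uE; ring.
have wmE : wm j.+1 = - (k * a) * (a * Dus - Dps - sg).
  by rewrite /wm pE uE; ring.
have idp : a * Dus + Dps + sg = wp j.+1 - wp j.
  by rewrite /Dus /Dps /sg /wp; field; rewrite gt_eqF.
have idm : a * Dus - Dps - sg = wm j.+1 - wm j.+2.
  by rewrite /Dus /Dps /sg /wm; field; rewrite gt_eqF.
split; rewrite mulrDl mul1r.
  by rewrite {1}wpE idp; ring.
by rewrite {1}wmE idm; ring.
Qed.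

Lemma acoustic_at_rest : acoustic_step g a dt m X Y ->
  forall j, (j <= (ncell m).+1)%N ->
  ac_vel Y j = 0 /\ ac_pi Y j = pressure g X j.
Proof.
move=> A.
have l0 j : (j <= (ncell m).+1)%N -> 1 + dt / dm m X j * a != 0.
  by move=> jN; rewrite gt_eqF // ltr_pwDl // mulr_ge0 ?divr_ge0 ?ltW ?dm_gt0.
have w_ghost j : ghost_cell m j -> wp j = 0 /\ wm j = 0.
  move=> gj; rewrite /wp /wm; have [_ -> ->] := ghost_unchanged gj.
  have jN : (j <= (ncell m).+1)%N by case: gj => ->.
  by rewrite lake_at_rest // subrr mulr0 addr0 subr0.
have wp0 j : (j <= (ncell m).+1)%N -> wp j = 0.
  elim: j => [_|j IH jN]; first by case: (w_ghost 0%N); [left|].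
  case: (interior_or_ghost jN) => [ij|/w_ghost[]//].
  have [+ _] := riemann_recursion A ij.
  rewrite (IH (ltnW jN)) mulr0 => /eqP.
  by rewrite mulf_eq0 (negPf (l0 _ jN)) => /eqP.
(* [wm] propagates leftwards, so the induction is on the distance [i] to the right ghost cell. *)
have wm0 i : forall j, (j + i = (ncell m).+1)%N -> wm j = 0.
  elim: i => [j|i IH j jN].
    by rewrite addn0 => ->; case: (w_ghost (ncell m).+1); [right|].
  have jN' : (j <= (ncell m).+1)%N by rewrite -jN leq_addr.
  case: (interior_or_ghost jN') => [|/w_ghost[]//].
  case: j jN jN' => [//|j] jN jN' ij.
  have wj : wm j.+2 = 0 by apply: IH; rewrite -jN addSnnS.
  have [_] := riemann_recursion A ij; rewrite wj mulr0 => /eqP.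
  by rewrite mulf_eq0 (negPf (l0 _ jN')) => /eqP.
move=> j jN; have := wp0 j jN.
have := wm0 _ j (subnKC jN); rewrite /wp /wm => Em Ep.
have u0 : ac_vel Y j = 0.
  apply: (mulfI (lt0r_neq0 a_gt0)); lra.
by split => //; move: Em; rewrite u0 mulr0 subr0 => /subr0_eq.
Qed.

(** All interface velocities vanish, since pressure and bed jumps cancel in [ustar]; the transport
    step is then the identity. *)
Lemma step_at_rest : lp_step g a dt m X Y X' -> whitham g a m X Y ->
  forall j, interior_cell m j -> height X' j = height X j /\ vel X' j = 0.
Proof.
move=> [A trh trq] W j ij; have rest := acoustic_at_rest A.
have us0 i : (i <= ncell m)%N -> us i = 0.
  move=> im; rewrite ustarE // /num_ustar bed_jump_at_rest //= .
  have [-> ->] := rest i (leqW im); have [-> ->] := rest i.+1 im.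
  by field; rewrite gt_eqF.
have [jm jm'] : (j <= ncell m)%N /\ (j.-1 <= ncell m)%N.
  by case/andP: ij => _ h; split => //; exact: leq_trans (leq_pred _) h.
have YX : ac_height Y j = height X j.
  rewrite -(height_lagrange A W ij) !us0 //; ring.
split.
  by rewrite (trh _ ij) -/us !us0 // YX; ring.
rewrite /vel (trq _ ij) -/us !us0 // /ac_discharge.
have [-> _] := rest j (interior_le ij).
by rewrite subrr !mulr0 !mul0r subrr mulr0 subr0 addr0 mul0r.
Qed.

End Step.

(** * Flat bottom, and assembly of the five properties *)

Lemma lp_step_flat (R : realType) (g a dt : R) (m : mesh R)
    (X : state R) (Y : acstate R) (X' : state R) :
  (forall j k, (j <= (ncell m).+1)%N -> (k <= (ncell m).+1)%N ->
     topo m j = topo m k) ->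
  lp_step g a dt m X Y X' <-> euler_lp_step g a dt m X Y X'.
Proof.
move=> flat.
have s0 j : (j <= ncell m)%N -> source_half g m X j = 0.
  move=> jm; rewrite /source_half (flat j.+1 j jm (leqW jm)).
  by rewrite subrr mul0r mulr0.
have usE j : (j <= ncell m)%N -> ustar g a m X Y j = euler_ustar a Y j.
  by move=> jm; rewrite /ustar s0 // mulr0 subr0.
have [cur prev] : (forall j, interior_cell m j -> (j <= ncell m)%N)
    /\ (forall j, interior_cell m j -> (j.-1 <= ncell m)%N).
  split=> j /andP[_ h] //; exact: leq_trans (leq_pred _) h.
have sc0 j : interior_cell m j -> source_cell g m X j = 0.
  move=> ij; rewrite /source_cell (s0 _ (cur _ ij)) (s0 _ (prev _ ij)).
  by rewrite !mulr0 addr0 mul0r.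
have trE phi phi' : transport_step dt m (ustar g a m X Y) phi phi'
    <-> transport_step dt m (euler_ustar a Y) phi phi'.
  by split=> tr j ij; have := tr j ij;
    rewrite /upwind (usE _ (cur _ ij)) (usE _ (prev _ ij)).
have acE : acoustic_step g a dt m X Y <-> euler_acoustic_step g a dt m X Y.
  rewrite /acoustic_step /euler_acoustic_step /=.
  by split=> A j ij; have := A j ij;
    rewrite (usE _ (cur _ ij)) (usE _ (prev _ ij)) sc0 // mulr0 subr0.
by split=> -[/acE A /trE th /trE tq].
Qed.

Theorem proposition3 (R : realType) (g a : R) (g_gt0 : 0 < g) (a_gt0 : 0 < a) :
  [/\
  (* (i) conservativity *)
  forall (m : mesh R) (dt : R) (X : state R) (Y : acstate R) (X' : state R),
    valid_data dt m X Y -> positive_height m X ->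
    lp_step g a dt m X Y X' -> whitham g a m X Y -> cfl g a dt m X Y ->
    let us := ustar g a m X Y in
    let ps := pistar a Y in
    (forall j, interior_cell m j ->
       height X' j = height X j
         - dt / dx m j * (us j * upwind us (ac_height Y) j
                          - us j.-1 * upwind us (ac_height Y) j.-1))
    /\
    ((forall j, interior_cell m j -> source_cell g m X j = 0) ->
     forall j, interior_cell m j ->
       discharge X' j = discharge X j
         - dt / dx m j * (us j * upwind us (ac_discharge Y) j + ps j
                          - us j.-1 * upwind us (ac_discharge Y) j.-1
                          - ps j.-1)),
  (* (ii) positivity *)
  forall (m : mesh R) (dt : nat -> R) (X : nat -> state R)
         (Y : nat -> acstate R),
    (forall n, [/\ valid_data (dt n) m (X n) (Y n),
                   lp_step g a (dt n) m (X n) (Y n) (X n.+1),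
                   whitham g a m (X n) (Y n)
                 & cfl g a (dt n) m (X n) (Y n)]) ->
    positive_height m (X 0%N) ->
    forall n, (0 < n)%N -> positive_height m (X n),
  (* (iii) well-balancing *)
  forall (m : mesh R) (dt : R) (X : state R) (Y : acstate R) (X' : state R),
    valid_data dt m X Y -> positive_height m X ->
    lp_step g a dt m X Y X' -> whitham g a m X Y -> cfl g a dt m X Y ->
    (forall j, (j <= (ncell m).+1)%N -> vel X j = 0) ->
    (forall j k, (j <= (ncell m).+1)%N -> (k <= (ncell m).+1)%N ->
       height X j + topo m j = height X k + topo m k) ->
    (forall j, ghost_cell m j ->
       [/\ ac_height Y j = height X j, ac_vel Y j = vel X j
         & ac_pi Y j = pressure g X j]) ->
    forall j, interior_cell m j -> height X' j = height X j /\ vel X' j = 0,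
  (* (iv) discrete entropy inequality *)
  exists (F : cellvars R -> cellvars R -> R)
         (S : cellvars R -> cellvars R -> cellvars R -> R -> R),
    [/\ consistent_flux g F, consistent_source g S &
    forall (m : mesh R) (dt : R) (X : state R) (Y : acstate R) (X' : state R),
      valid_data dt m X Y -> positive_height m X ->
      lp_step g a dt m X Y X' -> whitham g a m X Y -> cfl g a dt m X Y ->
      let c := cell_at m X Y in
      forall j, interior_cell m j ->
        entropy g (height X' j) (discharge X' j)
        - entropy g (height X j) (discharge X j)
        + dt / dx m j * (F (c j) (c j.+1) - F (c j.-1) (c j))
        <= - (dt * g * S (c j.-1) (c j) (c j.+1) (dx m j))] &
  (* (v) flat bottom *)
  forall (m : mesh R) (dt : R) (X : state R) (Y : acstate R) (X' : state R),
    valid_data dt m X Y -> positive_height m X ->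
    (forall j k, (j <= (ncell m).+1)%N -> (k <= (ncell m).+1)%N ->
       topo m j = topo m k) ->
    lp_step g a dt m X Y X' <-> euler_lp_step g a dt m X Y X'].

Proof.
split.
- move=> m dt X Y X' D P L W C us ps; split.
    exact: (height_conservative g_gt0 a_gt0 D P L W).
  move=> s0 j ij; rewrite (discharge_balance g_gt0 a_gt0 D P L W ij) s0 //.
  by rewrite mulr0 subr0.
- move=> m dt X Y H P0 n _; elim: n => // n IH j jN.
  have [D L W C] := H n.
  case: (interior_or_ghost jN) => [ij|gj].
    exact: (height_step_gt0 g_gt0 a_gt0 D IH L W C ij).
  (* Ghost heights are not updated by the step: their positivity is part of the data at [n.+1]. *)
  by have [[_ _ /(_ _ gj)[]]] := H n.+1.
- move=> m dt X Y X' D P L W _ rest flat ghost.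
  exact: (step_at_rest g_gt0 a_gt0 D P rest flat ghost L W).
- exists (num_flux g a), (num_source g a); split.
  + exact: num_flux_consistent.
  + exact: num_source_consistent.
  + move=> m dt X Y X' D P L W C c [//|j] ij.
    exact: (entropy_step g_gt0 a_gt0 D P L W C ij).
- by move=> m dt X Y X' _ _ flat; exact: lp_step_flat.
Qed.
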